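(* Let $\Gamma$ be a finite abelian group, let $S\subseteq\Gamma$ with $-S=S$, and suppose that $G=\operatorname{Cay}(\Gamma,S)$ is an integral Cayley graph over $\Gamma$. Let $D$ be a set of nonnegative integers, possibly also including $\infty$, i.e. $D\subseteq\{0,1,2,\ldots\}\cup\{\infty\}$. Then the distance power $G^D$ is also an integral Cayley graph over $\Gamma$; that is, there is a set $S'\subseteq\Gamma$ with $-S'=S'$ such that $G^D=\operatorname{Cay}(\Gamma,S')$, and all eigenvalues of $G^D$ are integers.
   Context: Groups are written additively. For a finite group $\Gamma$ and $S\subseteq\Gamma$ with $-S=\{-s: s\in S\}=S$, the undirected Cayley graph $\operatorname{Cay}(\Gamma,S)$ has vertex set $\Gamma$, and vertices $a,b\in\Gamma$ are adjacent if and only if $a-b\in S$. The case $0\in S$ is allowed and produces a loop at every vertex; $S=\emptyset$ is allowed. Eigenvalues of an undirected graph are the eigenvalues of its adjacency matrix (the $0/1$ matrix whose $(x,y)$ entry is $1$ iff $x,y$ are adjacent; a loop contributes a diagonal entry $1$). A graph is integral if all of its eigenvalues are integers. For an undirected graph $G=(V,E)$, $d(x,y)$ denotes the usual graph distance, with $d(x,x)=0$ and $d(x,y)=\infty$ if $x,y$ lie in different connected components. For a set $D$ as in the claim, the distance power $G^D$ is the undirected graph with vertex set $V$ in which $x,y$ are adjacent if and only if $d(x,y)\in D$ (so $0\in D$ gives a loop at every vertex). *)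

(* Defs.v *)
From HB Require Import structures.
From mathcomp Require Import all_boot all_order all_algebra all_field.
From mathcomp Require Import boolp classical_sets.

Set Implicit Arguments.
Unset Strict Implicit.
Unset Printing Implicit Defensive.

Import GRing.Theory Num.Theory.
Local Open Scope ring_scope.

(* A graph on a finite vertex type T is its adjacency relation [e : rel T];
   loops are allowed. *)

Definition cayley (G : finZmodType) (S : {set G}) : rel G :=
  fun a b => a - b \in S.

Definition adjmx (T : finType) (e : rel T) : 'M[algC]_#|T| :=
  \matrix_(i, j) (e (enum_val i) (enum_val j))%:R.

(* The adjacency matrix has integer entries, so algC contains all of its
   complex eigenvalues. *)
Definition integral_graph (T : finType) (e : rel T) : Prop :=
  forall a : algC, eigenvalue (adjmx e) a -> a \in Num.int.

Definition walk (T : finType) (e : rel T) (x y : T) (n : nat) : bool :=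
  [exists p : n.-tuple T, path e x p && (last x p == y)].

Lemma connect_walk (T : finType) (e : rel T) (x y : T) :
  connect e x y -> exists n, walk e x y n.
Proof.
move=> /connectP[p pP ->]; exists (size p); apply/existsP.
by exists (in_tuple p); rewrite pP eqxx.
Qed.

(* Lengths in {0, 1, 2, ...} together with infinity are encoded as option nat,
   None being infinity. *)
Definition graph_dist (T : finType) (e : rel T) (x y : T) : option nat :=
  if @idP (connect e x y) is ReflectT xy then Some (ex_minn (connect_walk xy))
  else None.

Definition dist_power (T : finType) (e : rel T) (D : set (option nat)) : rel T :=
  fun x y => graph_dist e x y \in D.

(* Main.v *)
Require Import Defs.
From HB Require Import structures.
From mathcomp Require Import all_boot all_order all_algebra all_field.
From mathcomp Require Import all_fingroup cyclic all_character.
From mathcomp Require Import boolp classical_sets.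

Set Implicit Arguments.
Unset Strict Implicit.
Unset Printing Implicit Defensive.

Import GRing.Theory Num.Theory.
Local Open Scope ring_scope.

(** Integrality of [cayley S] is equivalent to a symmetry of S: stability under
    all the maps x |-> k x with k coprime to the order of G
    ([integral_cayley_unit_stable]).  These maps are automorphisms of the
    group G, so when they preserve S they are automorphisms of the graph
    [cayley S], fixing the vertex 0; hence they preserve the set S' of vertices
    whose distance to 0 lies in D ([graph_dist_aut]).  As translations are also
    automorphisms of the graph, its distance power is [cayley S'], which is
    then integral by the equivalence read backwards.

    The equivalence rests on the fact that the eigenvalues of [cayley S] are
    the sums of the irreducible characters of G over S ([integral_cayleyP]).
    These sums lie in the cyclotomic field of |G|-th roots of unity, whose
    automorphisms raise these roots to a power k coprime to |G| and so turn the
    sum over the preimage of S under x |-> k x into the sum over S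
    ([charsum_aut]).  If all the sums over S are integers, then they are fixed
    by the automorphisms, so S and its preimage have the same character sums,
    and are equal because characters separate functions on G
    ([charsum_inj]).  Conversely, if S is stable then its character sums are
    fixed by all automorphisms, hence rational; being sums of roots of unity
    they are algebraic integers, hence integers. *)

(** * Graph distance and automorphisms *)

Lemma walk_homo (T T' : finType) (e : rel T) (e' : rel T') (f : T -> T')
    (x y : T) (n : nat) :
  {homo f : a b / e a b >-> e' a b} -> walk e x y n -> walk e' (f x) (f y) n.
Proof.
move=> homo_f /existsP[p /andP[e_p /eqP <-]].
apply/existsP; exists (map_tuple f p).
by rewrite /= last_map eqxx andbT (homo_path homo_f).
Qed.

Lemma walk_connect (T : finType) (e : rel T) (x y : T) (n : nat) :
  walk e x y n -> connect e x y.
Proof. by case/existsP=> p /andP[e_p /eqP xy]; apply/connectP; exists p. Qed.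

(** The distance is a dependent match on a proof of connectedness; this lemma
    reduces equalities of distances to boolean facts about walks. *)
Lemma eq_walk_dist (T T' : finType) (e : rel T) (e' : rel T') (x y : T)
    (x' y' : T') :
  walk e x y =1 walk e' x' y' -> graph_dist e x y = graph_dist e' x' y'.
Proof.
move=> eq_w; rewrite /graph_dist.
case: {-}_ / idP => [xy|nxy]; case: {-}_ / idP => [xy'|nxy'] //.
- by congr Some; apply: eq_ex_minn.
- by case: nxy'; have [n] := connect_walk xy; rewrite eq_w => /walk_connect.
- by case: nxy; have [n] := connect_walk xy'; rewrite -eq_w => /walk_connect.
Qed.

(** An injective self-map of a finite set has an inverse, so walks can be
    transported in both directions. *)
Lemma graph_dist_aut (T : finType) (e : rel T) (f : T -> T) (x y : T) :
  injective f -> {mono f : a b / e a b} ->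
  graph_dist e (f x) (f y) = graph_dist e x y.
Proof.
move=> inj_f mono_f; apply: eq_walk_dist => n.
apply/idP/idP => [/(walk_homo (e' := e) (f := invF inj_f))|].
  rewrite !invF_f; apply=> a b.
  by rewrite -{1}(f_invF inj_f a) -{1}(f_invF inj_f b) mono_f.
by apply: walk_homo => a b; rewrite mono_f.
Qed.

(** * Spectrum of the adjacency operator *)

(** Restates eigenvectors as functions on the vertices, so that the enumeration
    of the vertex type no longer appears. *)
Lemma eigenvalue_adjmxP (T : finType) (e : rel T) (a : algC) :
  reflect (exists2 w : T -> algC, (forall y, \sum_x w x * (e x y)%:R = a * w y)
             & exists x, w x != 0)
          (eigenvalue (adjmx e) a).
Proof.
have reindexE (F : T -> algC) : \sum_(i < #|T|) F (enum_val i) = \sum_x F x.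
  by rewrite [RHS](reindex _ (onW_bij _ (enum_val_bij T))).
apply: (iffP eigenvalueP) => [[v vA v0] | [w wA [x wx]]].
  exists (fun x => v 0 (enum_rank x)) => [y|].
    have /rowP/(_ (enum_rank y)) := vA; rewrite !mxE => <-.
    rewrite -reindexE; apply: eq_bigr => j _.
    by rewrite !mxE enum_valK enum_rankK.
  have /rV0Pn[j vj] := v0.
  by exists (enum_val j); rewrite enum_valK.
exists (\row_j w (enum_val j)).
  apply/rowP => j; rewrite !mxE -wA -reindexE.
  by apply: eq_bigr => k _; rewrite !mxE.
by apply/rV0Pn; exists (enum_rank x); rewrite mxE enum_rankK.
Qed.

Lemma eq_integral_graph (T : finType) (e e' : rel T) :
  e =2 e' -> integral_graph e' -> integral_graph e.
Proof.
move=> eq_e int_e'; rewrite /integral_graph.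
suff -> : adjmx e = adjmx e' by [].
by apply/matrixP => i j; rewrite !mxE eq_e.
Qed.

(** * Characters of a finite abelian group *)

Definition charsum (G : finZmodType) (i : Iirr [set: G]) (S : {set G}) : algC :=
  \sum_(s in S) 'chi_i s.

Lemma zmod_lin_char (G : finZmodType) (i : Iirr [set: G]) :
  'chi_i \is a linear_char.
Proof. by have /char_abelianP := FinRing.zmod_abelian [set: G]; apply. Qed.

Lemma zmod_charD (G : finZmodType) (i : Iirr [set: G]) (x y : G) :
  'chi_i (x + y) = 'chi_i x * 'chi_i y.
Proof. by rewrite -(lin_charM (zmod_lin_char i)) ?inE. Qed.

Lemma zmod_charMn (G : finZmodType) (i : Iirr [set: G]) (x : G) (k : nat) :
  'chi_i (x *+ k) = 'chi_i x ^+ k.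
Proof. by rewrite -(lin_charX (zmod_lin_char i)) ?inE. Qed.

Lemma zmod_charN (G : finZmodType) (i : Iirr [set: G]) (x : G) :
  'chi_i (- x) = ('chi_i x)^*.
Proof. by rewrite -(lin_charV_conj (zmod_lin_char i)) ?inE. Qed.

Lemma zmod_char_unity (G : finZmodType) (i : Iirr [set: G]) (x : G) :
  'chi_i x ^+ #|G| = 1.
Proof.
rewrite -cardsT -(lin_charX (zmod_lin_char i)) ?inE //.
by rewrite expg_cardG ?inE // (lin_char1 (zmod_lin_char i)).
Qed.

Lemma zmod_char_orthogonal (G : finZmodType) (x y : G) :
  \sum_(i : Iirr [set: G]) 'chi_i x * ('chi_i y)^* = #|G|%:R *+ (x == y).
Proof.
have abG := FinRing.zmod_abelian [set: G].
rewrite second_orthogonality_relation ?inE // -cardsT.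
have -> : 'C_([set: G])[x]%g = [set: G].
  apply/setP => z; rewrite finset.in_setI inE.
  exact/cent1P/FinRing.zmod_mulgC.
by move/abelian_classP: abG => ->; rewrite inE.
Qed.

(** Completeness of the characters: a function is recovered from its Fourier
    coefficients by the inversion formula, which is the second orthogonality
    relation. *)
Lemma zmod_char_separate (G : finZmodType) (f h : G -> algC) :
  (forall i : Iirr [set: G],
     \sum_x f x * ('chi_i x)^* = \sum_x h x * ('chi_i x)^*) ->
  f =1 h.
Proof.
have inversion (F : G -> algC) y : #|G|%:R * F y =
    \sum_(i : Iirr [set: G]) 'chi_i y * \sum_x F x * ('chi_i x)^*.
  under eq_bigr do rewrite mulr_sumr.
  rewrite exchange_big (bigD1 y) //= [X in _ + X]big1 => [|x xy].
    rewrite addr0; under eq_bigr do rewrite mulrCA.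
    by rewrite -mulr_sumr zmod_char_orthogonal eqxx mulrC.
  under eq_bigr do rewrite mulrCA.
  by rewrite -mulr_sumr zmod_char_orthogonal eq_sym (negPf xy) mulr0.
move=> eq_fh y; apply: (@mulfI _ #|G|%:R).
  by rewrite pnatr_eq0 -lt0n; apply/card_gt0P; exists 0.
by rewrite !inversion; apply: eq_bigr => i _; rewrite eq_fh.
Qed.

Lemma charsumE (G : finZmodType) (i : Iirr [set: G]) (S : {set G}) :
  charsum i S = \sum_x (x \in S)%:R * 'chi_i x.
Proof.
rewrite /charsum big_mkcond; apply: eq_bigr => x _.
by case: (x \in S); rewrite (mul1r, mul0r).
Qed.

(** The conjugates of the character sums are, up to the order of G, the Fourier
    coefficients of the indicator function of the set. *)
Lemma charsum_inj (G : finZmodType) (S S' : {set G}) :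
  (forall i : Iirr [set: G], charsum i S = charsum i S') -> S = S'.
Proof.
move=> eqS.
have conj_charsum (A : {set G}) i :
    (charsum i A)^* = \sum_x (x \in A)%:R * ('chi_i x)^*.
  rewrite charsumE rmorph_sum; apply: eq_bigr => x _.
  by rewrite rmorphM rmorph_nat.
have indic : (fun x => (x \in S)%:R : algC) =1 (fun x => (x \in S')%:R).
  by apply: zmod_char_separate => i; rewrite -!conj_charsum eqS.
apply/setP => x; have /eqP := indic x.
by rewrite eqr_nat; case: (x \in S); case: (x \in S').
Qed.

(** * Spectra of Cayley graphs *)

(** Each character is itself an eigenvector, with eigenvalue its sum over S.
    There is no other eigenvalue: by completeness an eigenvector w has a nonzero
    Fourier coefficient at some character, and comparing the coefficients of
    both sides of the eigenvalue equation there identifies the eigenvalue. *)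
Lemma integral_cayleyP (G : finZmodType) (S : {set G}) :
  integral_graph (cayley S) <->
  (forall i : Iirr [set: G], charsum i S \in Num.int).
Proof.
split=> [intS i | int_chi a /eigenvalue_adjmxP[w wA [z wz]]].
  apply/intS/eigenvalue_adjmxP; exists (fun x => 'chi_i x) => [y|]; last first.
    by exists 0; rewrite (lin_char_neq0 (zmod_lin_char i)) ?inE.
  rewrite charsumE mulr_suml (reindex_inj (addrI y)) /=.
  apply: eq_bigr => s _.
  by rewrite /cayley (addrC y) addrK zmod_charD mulrAC [_ * _%:R]mulrC.
have [i nz_i] : exists i : Iirr [set: G],
    \sum_x w x * ('chi_i x)^* != 0.
  apply: contrapT => /forallNP w0; case/eqP: wz.
  apply: (zmod_char_separate (h := fun=> 0)) => i.
  rewrite [RHS]big1 => [|x _]; last by rewrite mul0r.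
  by apply/eqP/negPn/negP/w0.
suff -> : a = charsum i S by [].
(* Both sides become double sums over a vertex x and an element s of S; the
   neighbour y of x is parametrised as x - s. *)
apply: (mulIf nz_i); rewrite mulr_sumr charsumE mulr_suml.
under eq_bigr do rewrite mulrA -wA mulr_suml.
rewrite exchange_big /=.
under [RHS]eq_bigr do rewrite mulr_sumr.
rewrite [RHS]exchange_big /=; apply: eq_bigr => x _.
rewrite [LHS](reindex_inj (inv_inj (subKr x))) /=.
apply: eq_bigr => s _.
rewrite /cayley subKr -!zmod_charN opprB zmod_charD.
by rewrite -!mulrA mulrCA; congr (_ * _); rewrite mulrCA.
Qed.

(** * Integrality and stability under multiplication by units *)

(** Galois theory, carried out in a finite Galois extension of the rationals
    containing the values of the characters; the Galois automorphisms all
    extend to the field of algebraic numbers. *)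
Lemma rational_fixed_charsum (G : finZmodType) (i : Iirr [set: G])
    (S : {set G}) :
  (forall nu : {rmorphism algC -> algC}, nu (charsum i S) = charsum i S) ->
  charsum i S \in Crat.
Proof.
have [Qn galQn [QnC nuQnC [_ _ Qn_chi]]] := group_num_field_exists [set: G].
have [a <-] : exists a, QnC a = charsum i S.
  rewrite /charsum; elim/big_ind: _ => [|_ _ [a <-] [b <-] | x _].
  - by exists 0; rewrite rmorph0.
  - by exists (a + b); rewrite rmorphD.
  - have [|a <-] := Qn_chi _ _ _ (irr_char i) x; last by exists a.
    by rewrite order_dvdG ?inE.
move=> fix_a.
have : a \in fixedField 'Gal({:Qn} / 1)%g.
  apply/fixedFieldP => [|nu _]; first exact: memvf.
  apply: (fmorph_inj QnC).
  have [nuC ->] := nuQnC nu.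
  exact: fix_a.
rewrite (galois_fixedField galQn) => /vlineP[q ->].
by rewrite alg_num_field fmorph_rat rpred_rat.
Qed.

(** An automorphism maps a primitive root of unity to another one, that is, to a
    coprime power of it, and all n-th roots are powers of that root. *)
Lemma aut_unity_root_exp (n : nat) (nu : {rmorphism algC -> algC}) :
  (0 < n)%N ->
  exists2 k, coprime k n & forall z : algC, z ^+ n = 1 -> nu z = z ^+ k.
Proof.
move=> /C_prim_root_exists[w prim_w].
have [|k nuw] := prim_rootP prim_w (x := nu w).
  by rewrite -rmorphXn prim_expr_order ?rmorph1.
exists k.
  by rewrite -(prim_root_exp_coprime _ prim_w) -nuw fmorph_primitive_root.
by move=> _ /(prim_rootP prim_w)[j ->]; rewrite rmorphXn nuw exprAC.
Qed.

Definition unit_stable (G : finZmodType) (S : {set G}) : Prop :=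
  forall k, coprime k #|G| -> forall x, (x *+ k \in S) = (x \in S).

Lemma mulrn_coprime_inj (G : finZmodType) (k : nat) :
  coprime k #|G| -> injective (fun x : G => x *+ k).
Proof.
rewrite coprime_sym -cardsT => /expgK K x y.
by move=> eq_xy; apply: (can_in_inj K); rewrite ?inE.
Qed.

Lemma charsum_mulrn (G : finZmodType) (i : Iirr [set: G]) (S : {set G}) k :
  coprime k #|G| ->
  charsum i S = \sum_(x | x *+ k \in S) 'chi_i x ^+ k.
Proof.
move=> /mulrn_coprime_inj inj_k; rewrite /charsum (reindex_inj inj_k) /=.
by apply: eq_bigr => x _; rewrite zmod_charMn.
Qed.

(** The k-th power of a character at x is its value at k x, and x |-> k x
    permutes G, so the sum over the preimage becomes the sum over S. *)
Lemma charsum_aut (G : finZmodType) (i : Iirr [set: G]) (S : {set G})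
    (nu : {rmorphism algC -> algC}) (k : nat) :
  coprime k #|G| -> (forall z : algC, z ^+ #|G| = 1 -> nu z = z ^+ k) ->
  nu (charsum i [set x | x *+ k \in S]) = charsum i S.
Proof.
move=> co_k nuE; rewrite (charsum_mulrn _ S co_k) rmorph_sum.
by apply: eq_big => [x | x _]; rewrite ?inE // nuE ?zmod_char_unity.
Qed.

(** Both directions compare S with its preimage under x |-> k x by means of an
    automorphism acting on |G|-th roots of unity as the k-th power: the
    integrality of S gives one such automorphism for each unit k, and
    conversely each automorphism acts in this way for some unit k. *)
Lemma integral_cayley_unit_stable (G : finZmodType) (S : {set G}) :
  integral_graph (cayley S) <-> unit_stable S.
Proof.
rewrite integral_cayleyP; split=> [intS k co_k x | stS i].
  have [nu nuE] := Qn_aut_exists co_k.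
  suff /setP/(_ x) : [set x | x *+ k \in S] = S by rewrite inE.
  apply: charsum_inj => i; apply: (fmorph_inj nu).
  by rewrite (charsum_aut _ _ co_k nuE) (aut_intr nu (intS i)).
apply: Cint_rat_Aint; last by rewrite rpred_sum // => x _; apply: Aint_irr.
apply: rational_fixed_charsum => nu.
have [|k co_k nuE] := @aut_unity_root_exp #|G| nu.
  by apply/card_gt0P; exists 0.
rewrite -[in RHS](charsum_aut i S co_k nuE); congr (nu (charsum i _)).
by apply/setP => x; rewrite inE stS.
Qed.

Theorem theorem3 (G : finZmodType) (S : {set G}) (D : set (option nat)) :
  [set - s | s in S]%SET = S ->
  integral_graph (cayley S) ->
  exists S' : {set G},
    [/\ [set - s | s in S']%SET = S',
        dist_power (cayley S) D =2 cayley S' &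
        integral_graph (dist_power (cayley S) D)].
Proof.
move=> symS /integral_cayley_unit_stable stS.
pose S' := [set g : G | graph_dist (cayley S) g 0 \in D].
have SN x : (- x \in S) = (x \in S).
  by rewrite -{1}symS (finset.mem_imset _ _ oppr_inj).
have S'N x : (- x \in S') = (x \in S').
  rewrite !inE -{1}oppr0 (graph_dist_aut _ _ oppr_inj) // => a b.
  by rewrite /cayley -opprD SN.
have powS' : dist_power (cayley S) D =2 cayley S'.
  move=> x y; rewrite /cayley inE /dist_power -(subrr y).
  rewrite (graph_dist_aut _ _ (addIr (- y))) // => a b.
  by rewrite /cayley opprD addrACA subrr addr0.
exists S'; split=> //.
  apply/setP => x; rewrite -{1}[x]opprK (finset.mem_imset _ _ oppr_inj).
  exact: S'N.
apply: eq_integral_graph powS' _; apply/integral_cayley_unit_stable => k co_k x.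
rewrite !inE -{1}(mul0rn G k).
rewrite (graph_dist_aut _ _ (mulrn_coprime_inj co_k)) // => a b.
by rewrite /cayley -mulrnBl stS.
Qed.
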